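(* Let $k,t_1,t_2$ be positive integers such that $k> t_1 > t_2 \geq 2$. Let $\mathbb{V}$ be a finite dimensional vector space over a field $\mathbb{F}$, and let $\mathcal{S}$ be a finite $(k;k-t_1,k-t_2)$-SPID in $\mathbb{V}$ with $n=|\mathcal{S}| \geq 3$, where $\dim\mathbb{V}\ge n t_1+(k-t_1)$. If $$\dim \langle\mathcal{S}\rangle \geq k+(t_1-1)(n-1)+2,$$ then $\mathcal{S}$ is a $(k-t_1)$-junta.
   Context: The field $\mathbb{F}$ may be finite or infinite. A $k$-space is a $k$-dimensional vector subspace; $\langle\mathcal{S}\rangle$ denotes the linear span of all members of $\mathcal{S}$, and dimensions are vector space dimensions. For distinct non-negative integers $\ell_1,\ell_2<k$, a set $\mathcal{S}$ of $k$-spaces of $\mathbb{V}$ is a $(k;\ell_1,\ell_2)$-SPID (Subspaces with Pre-assigned Intersection Dimensions) if for every two distinct $\pi_i,\pi_j\in\mathcal{S}$ we have $\dim(\pi_i\cap\pi_j)\in\{\ell_1,\ell_2\}$, and for each $\ell_m\in\{\ell_1,\ell_2\}$ there exist two distinct members $\pi_i,\pi_j$ of $\mathcal{S}$ with $\dim(\pi_i\cap\pi_j)=\ell_m$. Such an $\mathcal{S}$ is an $\ell$-junta if all elements of $\mathcal{S}$ contain a common $\ell$-dimensional subspace of $\mathbb{V}$. *)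

(* Defs.v *)
From mathcomp Require Import all_boot all_order all_algebra finmap.
Set Implicit Arguments.
Unset Strict Implicit.
Unset Printing Implicit Defensive.

Local Open Scope nat_scope.

(* [vectType F] is finite dimensional, and every linear subspace of V is
   represented by exactly one element of [{vspace V}], so that elements of a
   finite set of subspaces are distinct as subspaces. *)

Definition is_SPID (F : fieldType) (V : vectType F) (k l1 l2 : nat)
    (S : {fset {vspace V}}) : Prop :=
  [/\ l1 != l2, l1 < k & l2 < k] /\
  [/\ forall U, U \in S -> \dim U = k,
      forall U W, U \in S -> W \in S -> U != W ->
        \dim (U :&: W)%VS = l1 \/ \dim (U :&: W)%VS = l2,
      exists U W, [/\ U \in S, W \in S, U != W & \dim (U :&: W)%VS = l1]
    & exists U W, [/\ U \in S, W \in S, U != W & \dim (U :&: W)%VS = l2]].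

Definition is_junta (F : fieldType) (V : vectType F) (l : nat)
    (S : {fset {vspace V}}) : Prop :=
  exists L : {vspace V}, \dim L = l /\ forall U, U \in S -> (L <= U)%VS.

Definition span_of (F : fieldType) (V : vectType F)
    (S : {fset {vspace V}}) : {vspace V} := (\sum_(U <- S) U)%VS.

(* Main.v *)
(* As soon as some member U meets the span of the others in dimension
   exactly k - t, that intersection lies in every member.  Otherwise each U adds
   at most t - 1 to the dimension of the span, so the bound passes to S minus U,
   which has a common (k - t)-space by induction.  The span is too large for all
   pairwise intersections to exceed k - t, so some X, Y in S meet in exactly
   k - t; for Z distinct from X, Y the common space of S minus Z can then only be
   the intersection of X and Y.  As S has at least four members, Z can be chosen
   to avoid any given U, hence U contains the intersection of X and Y. *)
Require Import Defs.
From mathcomp Require Import all_boot all_order all_algebra finmap zify.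
Local Open Scope nat_scope.
Local Open Scope fset_scope.

Section Span.

Variables (F : fieldType) (V : vectType F).
Implicit Types (S : {fset {vspace V}}) (U W : {vspace V}).

Lemma span_ofD1 S U : U \in S -> span_of S = (U + span_of (S `\ U))%VS.
Proof. by move=> US; rewrite /span_of (big_fsetD1 U). Qed.

Lemma sub_span_of S U : U \in S -> (U <= span_of S)%VS.
Proof. by move=> US; rewrite (span_ofD1 S U US) addvSl. Qed.

(** If [W] is another member, adjoining [U] raises the dimension by at most [k - \dim (U :&: W)],
    hence by at most [t]. The parameter [t] stays free because the bound is needed with [t - 1]
    too. *)
Lemma dim_span_of_le k t S : S != fset0 ->
  (forall U, U \in S -> \dim U = k) ->
  (forall U W, U \in S -> W \in S -> U != W -> k <= \dim (U :&: W) + t) ->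
  \dim (span_of S) <= k + t * (#|` S| - 1).
Proof.
have [m Em] : exists m, #|` S| = m by eexists.
elim: m S Em => [|m IHm] S Em S0 dimS capS.
  by rewrite -cardfs_eq0 Em in S0.
have /fset0Pn [U US] := S0.
have cardD : #|` S `\ U| = m by have := cardfsD1 U S; rewrite US; lia.
have /esym dimE := dimv_sum_cap U (span_of (S `\ U)).
rewrite (span_ofD1 S U US); have UE := dimS U US.
have [D0 | D0] := eqVneq (S `\ U) fset0.
  by rewrite D0 /span_of big_seq_fset0 addv0 UE leq_addr.
have spanD : \dim (span_of (S `\ U)) <= k + t * (#|` S `\ U| - 1).
  apply: IHm => // [W /fsetD1P[_] | W1 W2 /fsetD1P[_ ?] /fsetD1P[_ ?]].
    exact: dimS.
  exact: capS.
have /fset0Pn [W WD] := D0; have /fsetD1P [WU WS] := WD.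
have capUW : k <= \dim (U :&: W) + t by apply: capS; rewrite // eq_sym.
have := dimvS (capvS (subvv U) (sub_span_of _ _ WD)).
have m_gt0 : 0 < m by rewrite -cardD cardfs_gt0.
move: spanD; rewrite cardD Em; nia.
Qed.

(** A mere lower bound on pairwise intersections passes to [S] minus a member, which may fail to
    realise both dimensions of a SPID; this lets the induction run. *)
Lemma junta_of_dim_span k t S : 0 < t -> t <= k ->
  (forall U, U \in S -> \dim U = k) ->
  (forall U W, U \in S -> W \in S -> U != W -> k <= \dim (U :&: W) + t) ->
  k + (t - 1) * (#|` S| - 1) + 2 <= \dim (span_of S) ->
  is_junta (k - t) S.
Proof.
move=> t_gt0 le_tk.
have [m Em] : exists m, #|` S| = m by eexists.
elim: m S Em => [|m IHm] S Em dimS capS spanS.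
  by move: spanS; rewrite (cardfs0_eq Em) /span_of big_seq_fset0 dimv0 addn2 ltn0.
have S0 : S != fset0 by rewrite -cardfs_gt0 Em.
have cardD U : U \in S -> #|` S `\ U| = m.
  by move=> US; have := cardfsD1 U S; rewrite US; lia.
have dimD U W : W \in S `\ U -> \dim W = k by case/fsetD1P => _; apply: dimS.
have capD U W1 W2 : W1 \in S `\ U -> W2 \in S `\ U -> W1 != W2 ->
    k <= \dim (W1 :&: W2) + t.
  by case/fsetD1P=> _ ? /fsetD1P[_ ?]; apply: capS.
have boundD U : U \in S -> S `\ U != fset0 ->
    \dim (span_of (S `\ U)) <= k + t * (m - 1).
  move=> US D0; rewrite -(cardD U US).
  by apply: dim_span_of_le; [|apply: dimD|apply: capD].
have m_gt0 : 0 < m.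
  have := dim_span_of_le k t S S0 dimS capS; rewrite Em; move: spanS; rewrite Em.
  by case: (m) => //; lia.
have D0 U : U \in S -> S `\ U != fset0.
  by move=> US; rewrite -cardfs_gt0 cardD.
have dimE U : U \in S ->
    (\dim (span_of S) + \dim (U :&: span_of (S `\ U)) =
     k + \dim (span_of (S `\ U)))%N.
  by move=> US; rewrite (span_ofD1 S U US) dimv_sum_cap dimS.
have [/hasP[U US /eqP capE] | /hasPn capN] :=
  boolP (has (fun U => \dim (U :&: span_of (S `\ U)) == k - t)%VS S).
  exists (U :&: span_of (S `\ U))%VS; split=> // W WS.
  have [-> | WU] := eqVneq W U; first exact: capvSl.
  have WD : W \in S `\ U by rewrite in_fsetD1 WU.
  have sub := capvS (subvv U) (sub_span_of _ _ WD).
  have capUW : k <= \dim (U :&: W) + t by apply: capS; rewrite // eq_sym.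
  (* The smaller space already has dimension at least [k - t], that of the larger one. *)
  have /eqP <- : (U :&: W == U :&: span_of (S `\ U))%VS.
    by rewrite -(geq_leqif (dimv_leqif_eq sub)) capE; lia.
  exact: capvSr.
(* Now [U] meets the span of the others in dimension at least [k - t + 1], so removing [U] costs at
   most [t - 1]. *)
have spanD U : U \in S -> k + (t - 1) * (m - 1) + 2 <= \dim (span_of (S `\ U)).
  move=> US; have /fset0Pn [W WD] := D0 U US; have /fsetD1P [WU WS] := WD.
  have capUW : k <= \dim (U :&: W) + t by apply: capS; rewrite // eq_sym.
  have := dimvS (capvS (subvv U) (sub_span_of _ _ WD)).
  have := dimE U US; have /eqP := capN U US; move: spanS; rewrite Em.
  nia.
(* Comparing [spanD] with [boundD] leaves [2 <= m - 1]; the summand 2 in the hypothesis is what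
   yields four members. *)
have m_ge3 : 2 < m.
  have /fset0Pn [U US] := S0.
  by have := spanD U US; have := boundD U US (D0 U US); nia.
have juntaD U : U \in S -> is_junta (k - t) (S `\ U).
  move=> US; apply: IHm; first exact: cardD.
  - exact: dimD.
  - exact: capD.
  - by rewrite (cardD U US); apply: spanD.
have [/hasP[X XS /hasP[Y YS /andP[XY /eqP capXY]]] | /hasPn noXY] :=
  boolP (has (fun X => has (fun Y => (X != Y) &&
                                    (\dim (X :&: Y)%VS == k - t)) S) S).
  exists (X :&: Y)%VS; split=> // U US.
  (* [U] may equal [X] or [Y]; the triple still has at most three elements, fewer than [m.+1]. *)
  have /fsubsetPn [Z ZS] : ~~ (S `<=` [fset X; Y; U]).
    apply/negP => /fsubset_leq_card; rewrite Em !cardfsU !cardfs1; lia.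
  rewrite !inE !negb_or -andbA => /and3P[ZX ZY ZU].
  have [L [dimL LP]] := juntaD Z ZS.
  have sub : (L <= X :&: Y)%VS.
    by rewrite subv_cap !LP // in_fsetD1 eq_sym ?ZX ?ZY.
  have /eqP <- : (L == X :&: Y)%VS.
    by rewrite -(geq_leqif (dimv_leqif_eq sub)) dimL capXY.
  by apply: LP; rewrite in_fsetD1 eq_sym ZU.
(* All pairs now meet in dimension above [k - t], so the general bound holds with [t - 1]. *)
suff : \dim (span_of S) <= k + (t - 1) * (#|` S| - 1) by lia.
apply: dim_span_of_le => // X Y XS YS XY.
have /hasPn /(_ Y YS) := noXY X XS.
by rewrite XY /= => /eqP; have := capS X Y XS YS XY; lia.
Qed.

End Span.
Local Close Scope fset_scope.

Theorem theorem2p1 (F : fieldType) (V : vectType F) (k t1 t2 n : nat)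
    (S : {fset {vspace V}})
    (ht1k : t1 < k) (ht21 : t2 < t1) (ht2 : 2 <= t2)
    (hS : is_SPID k (k - t1) (k - t2) S)
    (hn : n = #|` S|%fset) (hn3 : 3 <= n)
    (hV : n * t1 + (k - t1) <= \dim {:V}%VS)
    (hspan : k + (t1 - 1) * (n - 1) + 2 <= \dim (span_of S)) :
  is_junta (k - t1) S.
Proof.
have [_ [dimS capS _ _]] := hS.
(* Here [t] is [t1]: as [t2 < t1], the smaller of the two dimensions is [k - t1]. *)
apply: junta_of_dim_span; [lia | lia | exact: dimS | | by rewrite -hn].
by move=> U W US WS UW; case: (capS U W US WS UW) => ->; lia.
Qed.
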